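(* For every integer $d\ge 1$, setting $C_d = 10^9 d^3 2^{4d}$, the $d$-dimensional grid digraph $\vec{\Gamma}_{d,k}$ satisfies, for every integer $k\ge 1$, $$\vec{r}(\vec{\Gamma}_{d,k}) \leq C_d\, |V(\vec{\Gamma}_{d,k})|.$$
   Context: The $d$-dimensional grid digraph $\vec{\Gamma}_{d,k}$ has vertex set $\{1,\dots,k\}^d$, and its edges are all ordered pairs of vertices of the form $((x_1,\dots,x_i,\dots,x_d),(x_1,\dots,x_i+1,\dots,x_d))$ for some $i\in\{1,\dots,d\}$. A tournament on $N$ vertices is an orientation of the edges of the complete graph $K_N$. For an acyclic digraph $D$, the oriented Ramsey number $\vec{r}(D)$ is the minimum $N$ such that every tournament on $N$ vertices contains a copy of $D$, i.e. $D$ as a (not necessarily induced) subdigraph. *)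

(* Defs.v *)
From mathcomp Require Import all_boot.

Set Implicit Arguments.
Unset Strict Implicit.
Unset Printing Implicit Defensive.

(* A digraph on a finite vertex type V is its edge relation D : rel V. *)

Definition tournament (W : finType) (T : rel W) : Prop :=
  (forall x : W, ~~ T x x) /\
  (forall x y : W, x != y -> T x y (+) T y x).

(* Subdigraph, not necessarily induced: edges are preserved, not reflected. *)
Definition contains_copy (V W : finType) (D : rel V) (T : rel W) : Prop :=
  exists f : V -> W, injective f /\ (forall x y : V, D x y -> T (f x) (f y)).

Definition tournament_unavoidable (V : finType) (D : rel V) (N : nat) : Prop :=
  forall (W : finType) (T : rel W),
    #|W| = N -> tournament T -> contains_copy D T.

(* The oriented Ramsey number as a relation: no N qualifies when D has a
   directed cycle, since transitive tournaments are acyclic. *)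
Definition is_oriented_ramsey (V : finType) (D : rel V) (r : nat) : Prop :=
  tournament_unavoidable D r /\
  (forall N : nat, tournament_unavoidable D N -> r <= N).

Lemma is_oriented_ramsey_uniq (V : finType) (D : rel V) (r s : nat) :
  is_oriented_ramsey D r -> is_oriented_ramsey D s -> r = s.
Proof.
by move=> [ur mr] [us ms]; apply/eqP; rewrite eqn_leq (mr _ us) (ms _ ur).
Qed.

(* Coordinates run over 0, ..., k - 1 instead of 1, ..., k. *)
Definition grid_vertex (d k : nat) : finType := {ffun 'I_d -> 'I_k}.

Definition grid (d k : nat) : rel (grid_vertex d k) :=
  fun x y => [exists i : 'I_d,
    (val (y i) == (val (x i)).+1) && [forall j : 'I_d, (j != i) ==> (y j == x j)]].

Definition grid_const (d : nat) : nat := 10 ^ 9 * d ^ 3 * 2 ^ (4 * d).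

(* Main.v *)
(* The grid is graded by the coordinate sum, with layers of size at most
   [m = k ^ d.-1], and it is embedded layer by layer.  In a median order of the
   tournament every vertex is dominated by at least half of any interval ending
   just before it.  Going backwards through the order, dependent random choice
   (sampling [2 * d] vertices of the set [A] found last) yields, in one of the
   [4 * d] windows preceding [A], a large set [A'] with fewer than [(m / d) ^ d]
   poor [d]-tuples, that is, with fewer than [2 * m] common out-neighbours in
   [A]; splitting into windows keeps the loss of density near [1 / 2] down to
   a factor [1 - 1 / (4 * d)].  Along the resulting chain of sets the grid is
   embedded greedily: a tuple of which [u] coordinates are still free must keep
   fewer than [(m / d) ^ u] poor completions, which forbids fewer than [m / d]
   images per out-neighbour, hence fewer than [m] in all. *)
Require Import Defs.
From mathcomp Require Import all_boot zify.
From Stdlib Require Import Classical.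

Set Implicit Arguments.
Unset Strict Implicit.
Unset Printing Implicit Defensive.

(** * Median orders of a tournament *)

Section MedianOrder.
Variables (W : finType) (T : rel W).

Fixpoint forward_edges (s : seq W) : nat :=
  if s is x :: s' then count (T x) s' + forward_edges s' else 0.

Lemma forward_edges_cat s1 s2 :
  forward_edges (s1 ++ s2) =
  forward_edges s1 + forward_edges s2 + \sum_(x <- s1) count (T x) s2.
Proof.
elim: s1 => [|x s1 IH] /=; first by rewrite big_nil addn0.
rewrite IH big_cons count_cat; lia.
Qed.

(** Take an ordering with the most forward edges. Moving [v] in front of the block [q] changes only
    the status of the edges between [v] and [q], and by maximality this cannot gain. *)
Lemma median_order :
  exists s : seq W, [/\ uniq s, size s = #|W| &
    forall p q v r, s = p ++ q ++ v :: r ->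
      count (T v) q <= count (T^~ v) q].
Proof.
pose P (t : #|W|.-tuple W) := uniq t.
pose t0 := enum_tuple W.
have Pt0 : P t0 by rewrite /P /= enum_uniq.
have [t Pt tmax] := arg_maxnP (fun t : #|W|.-tuple W => forward_edges t) Pt0.
exists t; split=> //; first by rewrite size_tuple.
move=> p q v r Et.
have sz : size (p ++ v :: q ++ r) == #|W|.
  by have := size_tuple t; rewrite Et !size_cat /= size_cat; lia.
have pe : perm_eq (v :: q ++ r) (q ++ v :: r).
  by rewrite perm_sym perm_catC /= perm_cons perm_catC.
have ut : P (Tuple sz).
  by rewrite /P /= (perm_uniq (_ : perm_eq _ t)) // Et perm_cat2l.
have sumE : \sum_(x <- p) count (T x) (v :: q ++ r) =
            \sum_(x <- p) count (T x) (q ++ v :: r).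
  by apply: eq_bigr => x _; apply: (permP pe).
have : forward_edges (p ++ v :: q ++ r) <= forward_edges t := tmax _ ut.
rewrite Et !(forward_edges_cat p) sumE.
rewrite leq_add2r leq_add2l /= !forward_edges_cat /=.
have -> : \sum_(x <- q) count (T x) (v :: r) =
          count (T^~ v) q + \sum_(x <- q) count (T x) r.
  rewrite -sum1_count [X in _ = X + _]big_mkcond -big_split.
  by apply: eq_bigr => x _ /=; case: (T x v).
rewrite count_cat; lia.
Qed.

Hypothesis tT : tournament T.

Lemma tournament_count v q :
  v \notin q -> count (T v) q + count (T^~ v) q = size q.
Proof.
elim: q => //= x q IH; rewrite inE negb_or => /andP[vx /IH <-].
by have := tT.2 _ _ vx; case: (T v x); case: (T x v) => //= _; lia.
Qed.

End MedianOrder.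

(** * Inequalities for sums of powers, and cutting a sequence into windows *)

Section Sums.

(** The difference of the two sides is [(y - x) * (y ^ t - x ^ t)], whose factors have the same
    sign. *)
Lemma leq_mul_pow_add x y t : x * y ^ t + y * x ^ t <= x ^ t.+1 + y ^ t.+1.
Proof.
wlog le_xy : x y / x <= y => [H|].
  by case/orP: (leq_total x y) => /H; lia.
have le_t : x ^ t <= y ^ t by case: (t) => [|t'] //; rewrite leq_exp2r.
rewrite !expnS; nia.
Qed.

(** The power mean inequality, by induction on the exponent from Chebyshev's sum inequality. *)
Lemma sum_pow_leq (I : finType) (P : pred I) (F : I -> nat) t :
  (\sum_(i | P i) F i) ^ t.+1 <= #|P| ^ t * \sum_(i | P i) F i ^ t.+1.
Proof.
set S := fun t => \sum_(i | P i) F i ^ t.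
have -> : \sum_(i | P i) F i = S 1 by apply: eq_bigr => i _; rewrite expn1.
rewrite -/(S t.+1).
(* Once doubled, both sides are sums over pairs [(i, j)] that [leq_mul_pow_add] compares term by
   term. *)
have cheb u : S 1 * S u <= #|P| * S u.+1.
  rewrite -(leq_pmul2l (m := 2)) // mul2n -addnn.
  have -> : S 1 * S u + S 1 * S u =
      \sum_(i | P i) \sum_(j | P j) (F i * F j ^ u + F j * F i ^ u).
    rewrite {2}[S 1 * S u]mulnC !big_distrl /= -big_split.
    apply: eq_bigr => i _; rewrite !big_distrr /= -big_split.
    by apply: eq_bigr => j _ /=; rewrite expn1; lia.
  have -> : 2 * (#|P| * S u.+1) =
      \sum_(i | P i) \sum_(j | P j) (F i ^ u.+1 + F j ^ u.+1).
    under eq_bigr => i _ do rewrite big_split sum_nat_const.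
    by rewrite big_split /= sum_nat_const -big_distrr /=; rewrite -/(S u.+1); lia.
  by apply: leq_sum => i _; apply: leq_sum => j _; apply: leq_mul_pow_add.
elim: t => [|t IH]; first by rewrite expn1 mul1n.
rewrite expnS (leq_trans (leq_mul (leqnn _) IH)) //.
rewrite mulnCA expnSr -mulnA leq_mul2l cheb orbT //.
Qed.

(** Bernoulli's inequality: [(1 - 1 / q) ^ t] is at least [1 - t / q], hence at least [1 / 2]; [H]
    is its form without denominators. *)
Lemma bernoulli_half q t : 2 * t <= q -> q ^ t <= 2 * (q - 1) ^ t.
Proof.
have H : forall u, u <= q -> (q - u) * q ^ u <= q * (q - 1) ^ u.
  elim=> [|u IH] lt_uq; first by rewrite !expn0 subn0.
  have {}IH := IH (ltnW lt_uq).
  have E : (q - u.+1) * q <= (q - u) * (q - 1) by nia.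
  have := leq_mul (leqnn (q ^ u)) E; have := leq_mul IH (leqnn (q - 1)).
  rewrite !expnS; nia.
case: t => [|t] le_tq; first by rewrite !expn0.
have := H t.+1 ltac:(lia).
have : q * q ^ t.+1 <= 2 * ((q - t.+1) * q ^ t.+1).
  by rewrite mulnA leq_mul2r; apply/orP; right; lia.
have q0 : 0 < q by lia.
move=> h1 h2; rewrite -(leq_pmul2l q0); lia.
Qed.

Lemma big_windows (I : Type) (F : I -> nat) l q (b : seq I) :
  size b = q * l ->
  \sum_(x <- b) F x = \sum_(j < q) \sum_(x <- take l (drop (j * l) b)) F x.
Proof.
elim: q b => [|q IH] b; first by move/size0nil->; rewrite big_nil big_ord0.
move=> sb; rewrite big_ord_recl /= drop0 -{1}(cat_take_drop l b) big_cat /=.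
rewrite (IH (drop l b)); last by rewrite size_drop sb; lia.
congr (_ + _); apply: eq_bigr => j _.
by rewrite drop_drop mulSn addnC.
Qed.
End Sums.

(** * Dependent random choice, by double counting *)

Section Choice.
Variables (W : finType) (T : rel W).

Definition common_out (A : {set W}) (n : nat) (x : {ffun 'I_n -> W}) : {set W} :=
  [set y in A | [forall i, T (x i) y]].

Definition tuples_in (n : nat) (F : 'I_n -> {set W}) : {set {ffun 'I_n -> W}} :=
  [set x : {ffun 'I_n -> W} | [forall i, x i \in F i]].

(** Each coordinate has its own set: they all coincide in the dependent choice, but differ in the
    embedding, where filled coordinates are restricted to one image. *)
Definition poor_tuples (M : nat) (A : {set W}) (n : nat) (F : 'I_n -> {set W}) :=
  [set x in tuples_in F | #|common_out A x| < M].

Lemma card_tuples_in (n : nat) (F : 'I_n -> {set W}) :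
  #|tuples_in F| = \prod_(i < n) #|F i|.
Proof.
transitivity #|family (fun i => mem (F i))|; last first.
  by rewrite card_family foldrE big_map big_enum.
by apply: eq_card => x; rewrite inE unfold_in; apply: eq_forallb.
Qed.

Lemma card_tuples_in_const n (A : {set W}) :
  #|tuples_in (fun _ : 'I_n => A)| = #|A| ^ n.
Proof. by rewrite card_tuples_in prod_nat_const card_ord. Qed.

Variables (A : {set W}) (q l a0 m d : nat).
Variable (B : 'I_q -> {set W}).
(** [t] is the number of samples. In [P], a factor [2 ^ t] pays for density [1 / 2] at each sample,
    and one more factor 2 comes from [bernoulli_half]. *)
Let t := 2 * d.
Let P := 2 ^ t.+1.

Hypothesis q_gt0 : 0 < q.
Hypothesis d_gt0 : 0 < d.
Hypothesis m_gt0 : 0 < m.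
Hypothesis a0_gt0 : 0 < a0.
Hypothesis cardB : forall j, #|B j| <= l.
Hypothesis cardA : a0 <= #|A|.
Hypothesis lE : l = 2 * P * a0.
Hypothesis tq : 2 * t <= q.
Hypothesis a0E : a0 = 128 * P * d * m.
Hypothesis density :
  #|A| * (l * (q - 1)) <= 2 * \sum_(j < q) \sum_(u in B j) #|[set v in A | T u v]|.

Let samples := tuples_in (fun _ : 'I_t => A).
Let chosen (S : {ffun 'I_t -> W}) j := [set u in B j | [forall i, T u (S i)]].
Let poor S j := poor_tuples (2 * m) A (fun _ : 'I_d => chosen S j).

(** Exchanging the sums, [u] is counted once for each sample inside its out-neighbourhood in [A],
    that is [deg u ^ t] times; the power mean inequality then brings in [density]. *)
Let sum_chosen :
  #|A| ^ t * (q * l) <= P * \sum_(j < q) \sum_(S in samples) #|chosen S j|.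
Proof.
pose deg u := #|[set v in A | T u v]|.
have -> : \sum_(j < q) \sum_(S in samples) #|chosen S j| =
          \sum_(j < q) \sum_(u in B j) deg u ^ t.
  apply: eq_bigr => j _.
  under eq_bigr => S _ do rewrite -sum1_card.
  rewrite (exchange_big_dep (fun u => u \in B j)) /=; last first.
    by move=> S u _; rewrite inE => /andP[].
  apply: eq_bigr => u uB; rewrite sum1_card -card_tuples_in_const.
  apply: eq_card => S; rewrite unfold_in /= !inE uB.
  apply/andP/forallP => [[/forallP h1 /forallP h2] i|h].
    by rewrite inE h1 h2.
  by split; apply/forallP => i; have := h i; rewrite inE => /andP[].
have dens0 := density; rewrite pair_big_dep /= in dens0; rewrite pair_big_dep /=.
have := sum_pow_leq (fun p : 'I_q * W => p.2 \in B p.1) (fun p => deg p.2) t.-1.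
rewrite prednK; last by rewrite /t; lia.
set D := \sum_(p | _) deg p.2 in dens0 *; set X := \sum_(p | _) _ ^ t.
have cardP : #|[pred p : 'I_q * W | p.2 \in B p.1]| <= q * l.
  rewrite -sum1_card -(pair_big_dep xpredT (fun j u => u \in B j) (fun _ _ => 1)) /=.
  under eq_bigr => j _ do rewrite sum1_card.
  by rewrite -[q in q * l]card_ord -sum_nat_const; apply: leq_sum => j _.
move=> powD.
have {}powD : D ^ t <= (q * l) ^ t.-1 * X.
  by rewrite (leq_trans powD) // leq_mul2r leq_exp2r ?cardP ?orbT // /t; lia.
have l_gt0 : 0 < l by rewrite lE /P !muln_gt0 expn_gt0 a0_gt0.
have t_gt0 : 0 < t by rewrite /t; lia.
have : (#|A| * (l * (q - 1))) ^ t <= (2 * D) ^ t by rewrite leq_exp2r.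
have := bernoulli_half tq; rewrite !expnMn => bern dens.
have ql_gt0 : 0 < (q * l) ^ t.-1 by rewrite expn_gt0 muln_gt0 q_gt0 l_gt0.
rewrite -(leq_pmul2l ql_gt0).
have -> : (q * l) ^ t.-1 * (#|A| ^ t * (q * l)) = #|A| ^ t * (l ^ t * q ^ t).
  by rewrite mulnCA -expnSr prednK // expnMn; lia.
have -> : (q * l) ^ t.-1 * (P * X) = 2 * (2 ^ t * ((q * l) ^ t.-1 * X)).
  by rewrite /P expnS; lia.
apply: (@leq_trans (2 * (#|A| ^ t * (l ^ t * (q - 1) ^ t)))); last first.
  by rewrite leq_mul2l /= (leq_trans dens) // leq_mul2l powD orbT.
have := leq_mul (leqnn (#|A| ^ t * l ^ t)) bern; lia.
Qed.

(** A tuple is counted only for samples lying inside its common out-neighbourhood. For a poor tuple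
    this set has fewer than [2 * m] elements, which leaves at most [(2 * m) ^ t] samples. *)
Let sum_poor :
  \sum_(j < q) \sum_(S in samples) #|poor S j| <= q * (l ^ d * (2 * m) ^ t).
Proof.
rewrite -[q in q * _]card_ord -sum_nat_const; apply: leq_sum => j _.
under eq_bigr => S _ do rewrite -sum1_card.
rewrite (exchange_big_dep
  (fun x => x \in poor_tuples (2 * m) A (fun _ : 'I_d => B j))) /=; last first.
  move=> S x _; rewrite !inE => /andP[/forallP h ->]; rewrite andbT.
  by apply/forallP => i; have := h i; rewrite inE => /andP[].
apply: (@leq_trans
  (\sum_(x in poor_tuples (2 * m) A (fun _ : 'I_d => B j)) (2 * m) ^ t)).
  apply: leq_sum => x; rewrite !inE => /andP[_ xM].
  apply: (@leq_trans (#|common_out A x| ^ t)); last first.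
    by rewrite leq_exp2r ?(ltnW xM) // /t; lia.
  rewrite sum1_card -card_tuples_in_const; apply: subset_leq_card.
  apply/subsetP => S; rewrite unfold_in !inE => /andP[/forallP h1 /andP[/forallP h2 _]].
  apply/forallP => i; rewrite inE h1; apply/forallP => k.
  by have := h2 k; rewrite inE => /andP[_ /forallP].
rewrite sum_nat_const leq_mul2r; apply/orP; right.
apply: (@leq_trans #|tuples_in (fun _ : 'I_d => B j)|).
  by apply: subset_leq_card; apply/subsetP => x; rewrite inE => /andP[].
by rewrite card_tuples_in_const leq_exp2r.
Qed.

(** As [2 * P <= 16 ^ d], it suffices to compare bases of [d]-th powers:
    [16 * (d * l * (2 * m) ^ 2) <= m * a0 ^ 2]. The values of [l] and [a0] make this an equality,
    whence the 128. *)
Let parameters : 2 * P * ((d * l) ^ d * (2 * m) ^ t) <= m ^ d * a0 ^ t.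
Proof.
have P_le : 2 * P <= 16 ^ d.
  by rewrite /P -expnS (_ : 16 = 2 ^ 4) // -expnM leq_exp2l // /t; lia.
rewrite /t ![_ ^ (2 * d)]expnM -!expnMn (leq_trans (leq_mul P_le (leqnn _))) //.
rewrite -expnMn leq_exp2r // lE.
rewrite [X in _ <= m * X]expnS expn1 {2}a0E; lia.
Qed.

Lemma dependent_choice :
  exists j, exists2 A' : {set W}, A' \subset B j &
    a0 <= #|A'| /\ #|poor_tuples (2 * m) A (fun _ : 'I_d => A')| * d ^ d < m ^ d.
Proof.
case: (boolP [exists j, exists S,
  (a0 <= #|chosen S j|) && (#|poor S j| * d ^ d < m ^ d)]).
  case/existsP=> j /existsP[S /andP[h1 h2]]; exists j, (chosen S j) => //.
  by apply/subsetP => u; rewrite inE => /andP[].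
rewrite negb_exists => /forallP none; exfalso.
(* If every choice fails, either [chosen S j] is too small for the first term, or its poor tuples
   are so many that the second term suffices. The [+ 1] makes the summed inequality strict. *)
have bound j S : m ^ d * #|chosen S j| + 1 <= m ^ d * a0 + l * d ^ d * #|poor S j|.
  have chosenB : #|chosen S j| <= l.
    apply: leq_trans (cardB j); apply: subset_leq_card.
    by apply/subsetP => u; rewrite inE => /andP[].
  have md_gt0 : 0 < m ^ d by rewrite expn_gt0 m_gt0.
  have := none j; rewrite negb_exists => /forallP/(_ S).
  rewrite negb_and -ltnNge -leqNgt => /orP[lt_a0|le_md].
    by have := leq_mul (leqnn (m ^ d)) lt_a0; lia.
  have := leq_mul le_md chosenB.
  have : 0 < m ^ d * a0 by rewrite muln_gt0 md_gt0.
  by lia.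
have : \sum_(j < q) \sum_(S in samples) (m ^ d * #|chosen S j| + 1) <=
       \sum_(j < q) \sum_(S in samples) (m ^ d * a0 + l * d ^ d * #|poor S j|).
  by apply: leq_sum => j _; apply: leq_sum => S _.
under eq_bigr => j _ do rewrite big_split -big_distrr sum1_card /=.
under [X in _ <= X]eq_bigr => j _ do
  rewrite big_split /= -[X in _ + X]big_distrr sum_nat_const /=.
rewrite !big_split -!big_distrr /= !sum_nat_const card_ord card_tuples_in_const.
move: sum_chosen sum_poor parameters.
set X := \sum_(j < q) _; set Y := \sum_(j < q) _ => hX hY hpar hsum.
have At_gt0 : 0 < #|A| ^ t by rewrite expn_gt0 (leq_trans a0_gt0).
have P_gt0 : 0 < P by rewrite expn_gt0.
have hA : a0 ^ t <= #|A| ^ t by rewrite leq_exp2r // /t; lia.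
have h1 := leq_mul (leqnn (m ^ d)) hX.
have h2 := leq_mul (leqnn P) hsum.
have h3 := leq_mul (leqnn (P * l * d ^ d)) hY.
have h4 := leq_mul (leqnn (q * l)) (leq_trans hpar (leq_mul (leqnn (m ^ d)) hA)).
have h5 : 0 < P * (q * #|A| ^ t) by rewrite !muln_gt0 P_gt0 q_gt0.
(* The average size of [chosen S j] is at least [l / P = 2 * a0]: one half covers the [a0] term of
   [bound], and by [parameters] the other half covers the poor tuples. *)
have h6 : 2 * (P * (q * #|A| ^ t * (m ^ d * a0))) = m ^ d * (#|A| ^ t * (q * l)).
  by rewrite lE; lia.
rewrite expnMn in h4; move: h1 h2 h3 h4 h5 h6.
move: (#|A| ^ t) ((2 * m) ^ t) (m ^ d) (d ^ d) (l ^ d) P => At M md dd ld p.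
clear; lia.
Qed.
End Choice.

(** * A chain of rich sets going backwards along the median order *)

Section Chain.
Variables (W : finType) (T : rel W) (s : seq W) (d m : nat).
Hypothesis tT : tournament T.
Hypothesis s_uniq : uniq s.
Hypothesis s_median : forall p q v r, s = p ++ q ++ v :: r ->
  count (T v) q <= count (T^~ v) q.
Hypothesis d_gt0 : 0 < d.
Hypothesis m_gt0 : 0 < m.

Let P := 2 ^ (2 * d).+1.
Let a0 := 128 * P * d * m.
Let l := 2 * P * a0.
Let q := 4 * d.

Definition rich (A' A : {set W}) :=
  #|poor_tuples T (2 * m) A (fun _ : 'I_d => A')| * d ^ d < m ^ d.

(** At least half of everything from the start of [b] up to [v] dominates [v]; discarding the part
    of [w] before [v] costs at most [size w]. *)
Lemma median_in_degree p b w r v :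
  s = p ++ b ++ w ++ r -> v \in w -> size b - size w <= 2 * count (T^~ v) b.
Proof.
move=> sE /[dup] vw /path.splitPr wE; case: wE sE => w1 w2 sE.
have {}sE : s = p ++ (b ++ w1) ++ v :: (w2 ++ r) by rewrite sE -!catA.
have vN : v \notin b ++ w1.
  move: s_uniq; rewrite sE cat_uniq => /and3P[_ _].
  by rewrite cat_uniq /= negb_or => /and3P[_ /andP[]].
have := s_median sE; have := tournament_count tT vN.
have := count_size (T^~ v) w1; rewrite !count_cat !size_cat /=; lia.
Qed.

(** The last [q * l] entries of [p] are cut into [q] windows of length [l], and dependent choice
    finds [A'] inside one of them. A step thus consumes at most [q * l] entries. *)
Lemma chain_step p w r (A : {set W}) :
  s = p ++ w ++ r -> size w = l -> A \subset [set x in w] -> a0 <= #|A| ->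
  q * l <= size p ->
  exists p' w' r' (A' : {set W}),
    [/\ p = p' ++ w' ++ r', size w' = l, size p <= size p' + q * l,
        A' \subset [set x in w'] & a0 <= #|A'| /\ rich A' A].
Proof.
move=> sE sw Aw cardA sp.
pose b := drop (size p - q * l) p.
have sb : size b = q * l by rewrite size_drop; lia.
have pE : p = take (size p - q * l) p ++ b by rewrite cat_take_drop.
pose window (j : 'I_q) := take l (drop (j * l) b).
have b_uniq : uniq b.
  move: s_uniq; rewrite sE pE -catA cat_uniq => /and3P[_ _].
  by rewrite cat_uniq => /and3P[].
have w_uniq j : uniq (window j) by apply: take_uniq; apply: drop_uniq.
have size_w (j : 'I_q) : size (window j) = l.
  by rewrite size_take_min size_drop sb; have := ltn_ord j; nia.
have q_gt0 : 0 < q by rewrite /q; lia.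
have a0_gt0 : 0 < a0 by rewrite !muln_gt0 expn_gt0 d_gt0.
have windowsE (F : W -> nat) :
    \sum_(j < q) \sum_(u in [set x in window j]) F u = \sum_(u <- b) F u.
  rewrite (big_windows F sb); apply: eq_bigr => j _.
  rewrite big_uniq; last exact: w_uniq.
  by apply: eq_bigl => u; rewrite inE.
(* Counted from the side of [A]: each [v] has at least [(q * l - l) / 2] in-neighbours in [b], the
   loss being one window's length. *)
have density : #|A| * (l * (q - 1)) <=
    2 * \sum_(j < q) \sum_(u in [set x in window j]) #|[set v in A | T u v]|.
  rewrite windowsE.
  under eq_bigr => u _ do rewrite -sum1dep_card big_mkcondr /=.
  rewrite exchange_big /= big_distrr /= -sum_nat_const; apply: leq_sum => v vA.
  rewrite -big_mkcond sum1_count.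
  have vw : v \in w by have := subsetP Aw v vA; rewrite inE.
  have := @median_in_degree (take (size p - q * l) p) b w r v.
  rewrite catA -pE => /(_ sE vw); rewrite sb sw; apply: leq_trans.
  by rewrite mulnBr muln1 mulnC.
have cardB (j : 'I_q) : #|[set x in window j]| <= l.
  by rewrite cardsE (card_uniqP (w_uniq j)) size_w.
have tq : 2 * (2 * d) <= q by rewrite /q; lia.
have [j [A' A'w [cA' rA']]] :=
  dependent_choice q_gt0 d_gt0 m_gt0 a0_gt0 cardB cardA erefl tq erefl density.
exists (take (size p - q * l) p ++ take (j * l) b), (window j),
  (drop l (drop (j * l) b)), A'; split=> //.
- by rewrite -catA !cat_take_drop.
- by rewrite size_cat size_take_min; lia.
Qed.

(** Built from index [h] downwards. The sets are disjoint because all those found later lie in [p],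
    while [A] lies in [w]. *)
Lemma chain h p w r (A : {set W}) :
  s = p ++ w ++ r -> size w = l -> A \subset [set x in w] -> a0 <= #|A| ->
  h * (q * l) <= size p ->
  exists c : nat -> {set W},
    [/\ forall i, i <= h -> c i \subset [set x in p ++ w],
        forall i, i <= h -> a0 <= #|c i|,
        forall i, i < h -> rich (c i) (c i.+1) &
        forall i j, i < j <= h -> [disjoint c i & c j]] /\ c h = A.
Proof.
elim: h p w r A => [|h IH] p w r A sE sw Aw cardA sp.
  exists (fun _ => A); split=> //; split=> // [i _|i j]; last by lia.
  apply: subset_trans Aw _; apply/subsetP => x.
  by rewrite !inE mem_cat => ->; rewrite orbT.
have [] := chain_step sE sw Aw cardA; first by rewrite mulSn in sp; lia.
move=> p' [w' [r' [A' [pE sw' sp' A'w' [cardA' richA']]]]].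
have sE' : s = p' ++ w' ++ (r' ++ w ++ r) by rewrite sE pE -!catA.
have [|c [[csub ccard crich cdis] cA']] := IH p' w' _ A' sE' sw' A'w' cardA'.
  by rewrite mulSn in sp; lia.
have cp i : i <= h -> c i \subset [set x in p].
  move/csub => ci; apply: subset_trans ci _; apply/subsetP => x.
  by rewrite !inE pE catA !mem_cat => ->.
(* The shorter chain, ending in [A'], keeps its indices; [A] takes index [h.+1]. *)
exists (fun i => if i <= h then c i else A); split; last by rewrite ltnn.
split=> [i|i|i|i j].
- move=> _; case: (leqP _ h) => [/cp ci|_];
    [apply: subset_trans ci _|apply: subset_trans Aw _];
  by apply/subsetP => x; rewrite !inE mem_cat => ->; rewrite ?orbT.
- by move=> _; case: (leqP _ h) => [/ccard|].
- rewrite ltnS => le_ih; rewrite le_ih; case: (leqP _ h) => [/crich //|lt_hi].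
  by rewrite (_ : i = h) ?cA' //; lia.
- case/andP => lt_ij le_jh; have le_ih : i <= h by lia.
  rewrite le_ih; case: (leqP _ h) => [le_j|_]; first by apply: cdis; rewrite lt_ij.
  rewrite -setI_eq0 -subset0; apply: subset_trans (setISS (cp _ le_ih) Aw) _.
  apply/subsetP => x; rewrite !inE => /andP[xp xw].
  move: s_uniq; rewrite sE cat_uniq => /and3P[_ /hasPn/(_ x)].
  by rewrite mem_cat xw xp => /(_ isT).
Qed.

End Chain.

(** * Greedy embedding of a layered digraph whose edges carry [d] labels *)

Section Embedding.
Variables (V W : finType) (d m h : nat) (step : 'I_d -> rel V) (lay : V -> nat).
Variables (T : rel W) (c : nat -> {set W}).

Hypothesis step_lay : forall j v w, step j v w -> lay w = (lay v).+1.
Hypothesis step_fun : forall j v w w', step j v w -> step j v w' -> w = w'.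
Hypothesis step_inj : forall j v v' w, step j v w -> step j v' w -> v = v'.
Hypothesis step_label : forall i j v w, step i v w -> step j v w -> i = j.
Hypothesis lay_max : forall v, lay v <= h.
Hypothesis lay_card : forall n, #|[set v | lay v == n]| <= m.
Hypothesis d_gt0 : 0 < d.
Hypothesis m_gt0 : 0 < m.
Hypothesis card_c : forall i, i <= h -> 2 * m <= #|c i|.
Hypothesis disjoint_c : forall i j, i < j <= h -> [disjoint c i & c j].
Hypothesis rich_c : forall i, i < h -> rich T d m (c i) (c i.+1).

(* The admissible values in coordinate [j] of the tuple of images of the
   in-neighbours of [w], once the vertices of [E] have been embedded by [f]. *)
Definition slots (E : {set V}) (f : V -> W) (w : V) (j : 'I_d) : {set W} :=
  [set y in c (lay w).-1 | [forall v in E, step j v w ==> (y == f v)]].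

(** A direction in which [w] has no in-neighbour, as on the boundary of the grid, stays free
    forever, so that all tuples have [d] coordinates. *)
Definition free_slots (E : {set V}) (w : V) : {set 'I_d} :=
  [set j | [forall v in E, ~~ step j v w]].

Definition poor_completions E f w :=
  poor_tuples T (2 * m) (c (lay w)) (slots E f w).

(** The last condition bounds the poor completions by [(m / d) ^ u] for [u] free slots, without
    division. It concerns positive layers, where [(lay w).-1] is a genuine previous layer. *)
Definition partial_embedding (E : {set V}) (f : V -> W) :=
  [/\ forall v, v \in E -> f v \in c (lay v),
      {in E &, injective f},
      forall j v w, v \in E -> w \in E -> step j v w -> T (f v) (f w) &
      forall w, 0 < lay w ->
        #|poor_completions E f w| * d ^ #|free_slots E w| < m ^ #|free_slots E w|].

(** With nothing embedded all [d] slots are free, and the last condition is the richness of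
    consecutive sets of the chain. *)
Lemma partial_embedding0 (y : W) : partial_embedding set0 (fun _ => y).
Proof.
split=> [v|v v'|j v w|w w_gt0]; rewrite ?inE //.
have -> : #|free_slots set0 w| = d.
  rewrite -[RHS]card_ord -cardsT; congr #|pred_of_set _|; apply/setP => j.
  by rewrite !inE; apply/forall_inP => v; rewrite inE.
have [i wi] : exists i, lay w = i.+1 by exists (lay w).-1; rewrite prednK.
have /rich_c : i < h by rewrite -wi lay_max.
apply: leq_ltn_trans; rewrite leq_mul2r; apply/orP; right.
apply: subset_leq_card; apply/subsetP => x.
rewrite !inE wi /= => /andP[/forallP xF ->]; rewrite andbT.
by apply/forallP => j; have := xF j; rewrite inE wi /= => /andP[].
Qed.

(* Some completion of the images of the in-neighbours of [v] is not poor,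
   since there are more completions than poor ones. *)
Lemma many_candidates (E : {set V}) f v :
  partial_embedding E f -> v \notin E -> (forall u, lay u < lay v -> u \in E) ->
  2 * m <= #|[set y in c (lay v) | [forall u, [forall j, step j u v ==> T (f u) y]]]|.
Proof.
move=> [fc _ _ few] vE lowE.
have [v0|v_gt0] := posnP (lay v).
  apply: leq_trans (card_c (lay_max v)) _; apply: subset_leq_card.
  apply/subsetP => y yc; rewrite inE yc; apply/forallP => u; apply/forallP => j.
  by apply/implyP => /step_lay; rewrite v0.
have le_h : (lay v).-1 <= h by have := lay_max v; lia.
(* A free slot admits the whole preceding set; a filled one admits at least the image of its
   in-neighbour, which [step_inj] makes unique. *)
have completions : m ^ #|free_slots E v| <= #|tuples_in (slots E f v)|.
  rewrite card_tuples_in (bigID (mem (free_slots E v))) /=.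
  rewrite -[m ^ _]muln1; apply: leq_mul.
    rewrite -prod_nat_const; apply: leq_prod => j; rewrite inE => /forall_inP jfree.
    apply: leq_trans (_ : 2 * m <= _); first by lia.
    apply: leq_trans (card_c le_h) _; apply: subset_leq_card; apply/subsetP => y yc.
    rewrite inE yc; apply/forall_inP => u /jfree; by case: (step j u v).
  rewrite prodn_cond_gt0 // => j; rewrite inE negb_forall => /existsP[u].
  rewrite negb_imply negbK => /andP[uE uv]; apply/card_gt0P; exists (f u).
  rewrite inE (_ : (lay v).-1 = lay u) ?fc //; last by rewrite (step_lay uv).
  by apply/forall_inP => u' _; apply/implyP => /step_inj -/(_ _ uv) ->.
have /subsetPn[x xF xN] : ~~ (tuples_in (slots E f v) \subset poor_completions E f v).
  apply/negP => /subset_leq_card sub; have := few v v_gt0; apply/negP; rewrite -leqNgt.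
  apply: leq_trans completions _; apply: leq_trans sub _.
  by rewrite leq_pmulr // expn_gt0 d_gt0.
move: xN; rewrite inE xF /= -leqNgt => /leq_trans; apply.
apply: subset_leq_card; apply/subsetP => y; rewrite !inE => /andP[-> /forallP Ty].
apply/forallP => u; apply/forallP => j; apply/implyP => uv.
have uE : u \in E by apply: lowE; rewrite (step_lay uv).
move: xF; rewrite inE => /forallP/(_ j); rewrite inE => /andP[_ /forall_inP/(_ u uE)].
by rewrite uv => /eqP <-.
Qed.

Definition update (f : V -> W) v y u := if u == v then y else f u.

Lemma slots_update (E : {set V}) (f : V -> W) v y w j : v \notin E ->
  slots (v |: E) (update f v y) w j =
  if step j v w then slots E f w j :&: [set y] else slots E f w j.
Proof.
move=> vE; apply/setP => z; rewrite [LHS]inE.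
have -> : [forall u in v |: E, step j u w ==> (z == update f v y u)] =
    (step j v w ==> (z == y)) && [forall u in E, step j u w ==> (z == f u)].
  apply/forall_inP/andP => [H|[Hv /forall_inP H] u].
    split; first by have := H v (setU11 _ _); rewrite /update eqxx.
    apply/forall_inP => u uE; have := H u (setU1r _ uE).
    by have /negbTE uv : u != v by [apply: contraNneq vE => <-]; rewrite /update uv.
  rewrite in_setU1 /update; case: eqP => [-> _ //|_ /= uE]; exact: H.
by case: ifP => _; rewrite !inE //= andbA andbAC.
Qed.

Lemma free_slots_update (E : {set V}) v w :
  v \notin E -> free_slots (v |: E) w = free_slots E w :\: [set j | step j v w].
Proof.
move=> vE; apply/setP => j; rewrite !inE; apply/forall_inP/andP => [H|[vw /forall_inP H] u].
  split; first by apply: H; rewrite setU11.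
  by apply/forall_inP => u uE; apply: H; rewrite setU1r.
by rewrite !inE => /orP[/eqP -> //|/H].
Qed.

(** The images of [v] that would break the last invariant at its out-neighbour in direction [j]; the
    exponent drops by one since [v] fills slot [j] there. *)
Definition spoiled E f v j : {set W} :=
  [set y | [exists w, step j v w &&
     (m ^ #|free_slots E w|.-1 <=
      #|poor_completions (v |: E) (update f v y) w| * d ^ #|free_slots E w|.-1)]].

(** Distinct images [y] fix slot [j] of [w] to distinct values, so their sets of poor completions
    are disjoint parts of the previous one. Too many spoiled images would exceed the previous
    bound. *)
Lemma few_spoiled (E : {set V}) f v j :
  partial_embedding E f -> v \notin E -> #|spoiled E f v j| * d < m.
Proof.
move=> [_ _ _ few] vE.
case: (boolP [exists w, step j v w]) => [/existsP[w vw]|none]; last first.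
  rewrite (_ : spoiled E f v j = set0) ?cards0 ?mul0n //.
  apply/setP => y; rewrite !inE; apply/negbTE.
  apply: contra none => /existsP[w /andP[vw _]]; by apply/existsP; exists w.
set u := #|free_slots E w|.
have jfree : j \in free_slots E w.
  rewrite inE; apply/forall_inP => v' v'E; apply/negP => /step_inj -/(_ _ vw) v'v.
  by rewrite -v'v v'E in vE.
have u_gt0 : 0 < u by apply/card_gt0P; exists j.
have w_gt0 : 0 < lay w by rewrite (step_lay vw).
have slotE y k : slots (v |: E) (update f v y) w k =
    if k == j then slots E f w k :&: [set y] else slots E f w k.
  rewrite slots_update //; case: eqP => [->|kj]; first by rewrite vw.
  by case: ifP => // /step_label -/(_ _ vw) /kj.
have total : \sum_y #|poor_completions (v |: E) (update f v y) w| <=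
             #|poor_completions E f w|.
  under eq_bigr => y _ do rewrite -sum1_card.
  rewrite (exchange_big_dep (fun x => x \in poor_completions E f w)) /=.
    rewrite -sum1_card; apply: leq_sum => x _; rewrite sum1_card.
    rewrite -(cards1 (x j)); apply: subset_leq_card; apply/subsetP => y.
    rewrite inE => xP; move: (xP : x \in poor_completions _ _ _).
    rewrite !inE => /andP[/forallP/(_ j)]; rewrite slotE eqxx !inE.
    by move=> /andP[_ /eqP ->].
  move=> y x _; rewrite !inE => /andP[/forallP xF ->]; rewrite andbT.
  apply/forallP => k; have := xF k; rewrite slotE; case: ifP => // _.
  by rewrite inE => /andP[].
have part : #|spoiled E f v j| * m ^ u.-1 <= #|poor_completions E f w| * d ^ u.-1.
  apply: leq_trans (leq_mul total (leqnn _)); rewrite -sum_nat_const big_distrl /=.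
  rewrite [X in _ <= X](bigID (mem (spoiled E f v j))) /=.
  apply: leq_trans (leq_addr _ _); apply: leq_sum => y.
  rewrite inE => /existsP[w' /andP[vw']].
  by rewrite (step_fun vw' vw).
have := few w w_gt0; rewrite -/u -{1 2}(prednK u_gt0) !expnS => lt_few.
have : m ^ u.-1 * (#|spoiled E f v j| * d) < m ^ u.-1 * m by nia.
by rewrite ltn_mul2l => /andP[].
Qed.

(** Of the [2 * m] candidates, fewer than [m] are used by the layer of [v] and fewer than [m] are
    spoiled. Images of lower layers cannot collide, as the sets [c i] are disjoint. *)
Lemma partial_embedding_extend (E : {set V}) f v :
  partial_embedding E f -> v \notin E -> (forall u, lay u < lay v -> u \in E) ->
  (forall u, u \in E -> lay u <= lay v) ->
  exists y, partial_embedding (v |: E) (update f v y).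
Proof.
move=> Ef vE lowE Elow.
set Y := [set y in c (lay v) | [forall u, [forall j, step j u v ==> T (f u) y]]].
pose used := [set f u | u in E & lay u == lay v].
pose spoil := \bigcup_j spoiled E f v j.
(* The inequality is strict because [v] belongs to its layer but is not yet embedded. *)
have used_lt : #|used| < m.
  apply: leq_ltn_trans (leq_imset_card _ _) _.
  apply: leq_trans (lay_card (lay v)); apply: proper_card; apply/properP; split.
    by apply/subsetP => u; rewrite !inE => /andP[].
  by exists v; rewrite !inE ?eqxx // (negbTE vE).
have spoil_lt : #|spoil| < m.
  have le_sum : #|spoil| <= \sum_j #|spoiled E f v j|.
    rewrite /spoil.
    apply: (big_ind2 (fun (A : {set W}) n => #|A| <= n))
      => [|A1 n1 A2 n2 h1 h2|//].
      by rewrite cards0.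
    by apply: leq_trans (leq_card_setU _ _) _; apply: leq_add.
  apply: leq_ltn_trans le_sum _; rewrite -(ltn_pmul2r d_gt0) big_distrl /=.
  apply: (@leq_ltn_trans (\sum_(j < d) m.-1)).
    by apply: leq_sum => j _; rewrite -ltnS prednK //; apply: few_spoiled.
  by rewrite sum_nat_const card_ord; nia.
have /subsetPn[y yY] : ~~ (Y \subset used :|: spoil).
  apply/negP => /subset_leq_card; have := many_candidates Ef vE lowE; rewrite -/Y.
  have := (leq_card_setU used spoil).1; lia.
rewrite inE negb_or => /andP[yused yspoil]; exists y.
case: Ef => fc finj fstep few.
have [yc Ty] : y \in c (lay v) /\ forall u j, step j u v -> T (f u) y.
  move: yY; rewrite inE => /andP[-> /forallP Ty]; split=> // u j.
  by have /forallP/(_ j)/implyP := Ty u.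
have upd u : u \in E -> update f v y u = f u.
  by rewrite /update; case: eqP => // ->; rewrite (negbTE vE).
have updv : update f v y v = y by rewrite /update eqxx.
have fresh u : u \in E -> f u <> y.
  move=> uE fu; case: (ltngtP (lay u) (lay v)) (Elow u uE) => // [lt_uv _|eq_uv _].
    have := disjoint_c (i := lay u) (j := lay v); rewrite lt_uv lay_max => /(_ isT).
    by move/disjointFr/(_ (fc u uE)); rewrite fu yc.
  by case/imsetP: yused; exists u; rewrite // inE uE eq_uv eqxx.
split.
- by move=> u; rewrite in_setU1 => /orP[/eqP ->|uE]; rewrite ?updv ?upd ?fc.
- move=> u u'; rewrite !in_setU1 => /orP[/eqP ->|uE] /orP[/eqP ->|u'E] //;
    rewrite ?updv ?(upd _ uE) ?(upd _ u'E).
  + by move/esym/(fresh _ u'E).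
  + by move/(fresh _ uE).
  + exact: finj.
- move=> j u w; rewrite !in_setU1 => /orP[/eqP ->|uE] /orP[/eqP ->|wE].
  + by move/step_lay; lia.
  + by move/step_lay; have := Elow w wE; lia.
  + by rewrite updv (upd _ uE); apply: Ty.
  + by rewrite (upd _ uE) (upd _ wE); apply: fstep.
move=> w w_gt0; rewrite free_slots_update //.
case: (boolP [exists j, step j v w]) => [/existsP[j vw]|none]; last first.
  have none' j : step j v w = false.
    by apply: contraNF none => vw; apply/existsP; exists j.
  have -> : free_slots E w :\: [set j | step j v w] = free_slots E w.
    by apply/setP => j; rewrite !inE none'.
  rewrite (_ : poor_completions _ _ w = poor_completions E f w) ?few //.
  apply/setP => x; rewrite !inE; congr (_ && _); apply: eq_forallb => j.
  by rewrite slots_update // none'.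
have jfree : j \in free_slots E w.
  rewrite inE; apply/forall_inP => v' v'E; apply/negP => /step_inj -/(_ _ vw) v'v.
  by rewrite -v'v v'E in vE.
have -> : free_slots E w :\: [set i | step i v w] = free_slots E w :\ j.
  apply/setP => i; rewrite !inE; congr (~~ _ && _).
  by apply/idP/eqP => [/step_label -/(_ _ vw)|->].
have -> : #|free_slots E w :\ j| = #|free_slots E w|.-1.
  by rewrite [in RHS](cardsD1 j) jfree.
rewrite ltnNge; apply: contra yspoil => le_m; apply/bigcupP; exists j => //.
by rewrite inE; apply/existsP; exists w; rewrite vw.
Qed.

(** Vertices are added one at a time, always an unembedded one of least layer, so that every lower
    layer is already complete. *)
Lemma layered_embedding :
  exists f : V -> W, injective f /\ forall j v w, step j v w -> T (f v) (f w).
Proof.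
have /card_gt0P[y _] : 0 < #|c 0| by have := card_c (leq0n h); lia.
suff H n : n <= #|V| -> exists (E : {set V}) f,
    [/\ #|E| = n, partial_embedding E f &
        forall u v, u \in E -> v \notin E -> lay u <= lay v].
  have [E [f [cardE [_ finj fstep _] _]]] := H _ (leqnn _).
  have ET u : u \in E.
    have /eqP -> : E == setT by rewrite eqEcard subsetT cardsT cardE leqnn.
    by rewrite inE.
  by exists f; split=> [u v|j v w];
    [exact: finj (ET u) (ET v) | exact: fstep (ET v) (ET w)].
elim: n => [|n IH] n_lt.
  exists set0, (fun _ => y); split; [exact: cards0|exact: partial_embedding0|].
  by move=> u v; rewrite inE.
have [E [f [cardE Ef Elay]]] := IH (ltnW n_lt).
have /subsetPn[v0 _ v0E] : ~~ ([set: V] \subset E).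
  by apply/negP => /subset_leq_card; rewrite cardsT cardE; lia.
have [v /= vE vmin] := arg_minnP (P := [pred v | v \notin E]) lay v0E.
have [u lt_uv|u uE|z Ez] := partial_embedding_extend Ef vE.
- by apply: contraLR lt_uv => /vmin; rewrite -leqNgt.
- exact: Elay.
exists (v |: E), (update f v z); split=> //; first by rewrite cardsU1 vE cardE.
move=> u u'; rewrite !in_setU1 negb_or => /orP[/eqP ->|uE] /andP[_ u'E].
  exact: vmin.
exact: Elay.
Qed.

End Embedding.

(** * The grid as a layered digraph, and the final count *)

Section Grid.
Variables (d k : nat).

Definition grid_step (j : 'I_d) : rel (grid_vertex d k) :=
  fun x y => (val (y j) == (val (x j)).+1) &&
             [forall i : 'I_d, (i != j) ==> (y i == x i)].

Definition grid_layer (x : grid_vertex d k) : nat := \sum_(j < d) x j.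

Lemma grid_stepP j (x y : grid_vertex d k) :
  reflect (val (y j) = (val (x j)).+1 /\ forall i, i != j -> y i = x i)
          (grid_step j x y).
Proof.
apply: (iffP andP) => [[/eqP yj /forallP H]|[yj H]].
  by split=> // i ij; have := H i; rewrite ij => /eqP.
by split; [apply/eqP|apply/forallP => i; apply/implyP => /H ->].
Qed.

Lemma grid_step_layer j x y : grid_step j x y -> grid_layer y = (grid_layer x).+1.
Proof.
case/grid_stepP => yj H; rewrite /grid_layer (bigD1 j) //= [in RHS](bigD1 j) //= yj addSn.
by congr (_ + _).+1; apply: eq_bigr => i /H ->.
Qed.

Lemma grid_step_fun j x y y' : grid_step j x y -> grid_step j x y' -> y = y'.
Proof.
move=> /grid_stepP[yj H] /grid_stepP[yj' H']; apply/ffunP => i.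
have [->|ij] := eqVneq i j; first by apply: val_inj; rewrite yj yj'.
by rewrite H // H'.
Qed.

Lemma grid_step_inj j x x' y : grid_step j x y -> grid_step j x' y -> x = x'.
Proof.
move=> /grid_stepP[xj H] /grid_stepP[xj' H']; apply/ffunP => i.
have [->|ij] := eqVneq i j; first by apply: val_inj; apply: succn_inj; rewrite -xj.
by rewrite -H // H'.
Qed.

Lemma grid_step_label i j x y : grid_step i x y -> grid_step j x y -> i = j.
Proof.
move=> /grid_stepP[_ H] /grid_stepP[xj _]; apply/eqP; apply: contraT => ij.
by move: xj; rewrite H; [lia|rewrite eq_sym].
Qed.

Lemma grid_layer_max x : grid_layer x <= d * k.-1.
Proof.
rewrite -[d in d * _]card_ord -sum_nat_const; apply: leq_sum => j _.
by have := ltn_ord (x j); lia.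
Qed.

End Grid.

(* All coordinates but the first determine the first one within a layer. *)
Lemma card_grid_layer d k n :
  #|[set x : grid_vertex d.+1 k | grid_layer x == n]| <= k ^ d.
Proof.
pose tail (x : grid_vertex d.+1 k) : {ffun 'I_d -> 'I_k} := [ffun j => x (lift ord0 j)].
rewrite -[k ^ d](_ : #|{ffun 'I_d -> 'I_k}| = _); last first.
  by rewrite card_ffun !card_ord.
rewrite -(card_in_imset (f := tail)); first exact: max_card.
move=> x y; rewrite !inE /grid_layer !big_ord_recl => /eqP xn /eqP yn xy.
have tailE j : x (lift ord0 j) = y (lift ord0 j)
    by move/ffunP/(_ j): (xy); rewrite !ffunE.
have head : x ord0 = y ord0.
  apply: val_inj => /=; move: xn; rewrite -yn.
  by under eq_bigr => j _ do rewrite tailE; move/eqP; rewrite eqn_add2r => /eqP.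
apply/ffunP => j; by case: (unliftP ord0 j) => [i ->|->].
Qed.

(* [10 ^ 9] is a unary number: any step that evaluates it exhausts memory. *)
Lemma grid_const_ge d : 2 ^ 12 * d ^ 3 * 2 ^ (4 * d) <= grid_const d.
Proof.
rewrite /grid_const !leq_mul2r.
suff -> : 2 ^ 12 <= 10 ^ 9 by rewrite !orbT.
apply: (@leq_trans (10 ^ 6)); last by rewrite leq_exp2l.
by rewrite -[12]/(2 * 6) expnM leq_exp2r.
Qed.

(** The chain starts from the last [l] vertices of a median order and supplies one set for each of
    the layers [0] to [h]. *)
Lemma grid_unavoidable d k : 0 < d -> 0 < k ->
  tournament_unavoidable (@grid d k) (grid_const d * #|grid_vertex d k|).
Proof.
move=> d_gt0 k_gt0 W T cardW tT.
have [s [s_uniq size_s s_median]] := median_order T.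
pose m := k ^ d.-1; pose P := 2 ^ (2 * d).+1; pose a0 := 128 * P * d * m.
pose l := 2 * P * a0; pose h := d * k.-1; pose q := 4 * d.
have m_gt0 : 0 < m by rewrite expn_gt0 k_gt0.
have large : h * (q * l) + l <= #|W|.
  have PP : P * P = 4 * 2 ^ (4 * d).
    by rewrite /P -expnD -[4 in RHS]/(2 ^ 2) -expnD; congr (2 ^ _); lia.
  have h_lt : h.+1 <= d * k by rewrite /h; nia.
  have l_le : l <= q * l by rewrite leq_pmull // muln_gt0.
  rewrite cardW card_ffun !card_ord.
  have -> : k ^ d = k * m by rewrite -expnS prednK.
  apply: (@leq_trans (h.+1 * (q * l))); first by rewrite mulSn; lia.
  apply: (leq_trans (leq_mul h_lt (leqnn _))).
  (* Here [q * l] is [1024 * d ^ 2 * P ^ 2 * m], and [P ^ 2] supplies [4 * 2 ^ (4 * d)]. *)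
  have -> : d * k * (q * l) = 2 ^ 12 * d ^ 3 * 2 ^ (4 * d) * (k * m).
    rewrite /q /l /a0.
    have -> : d ^ 3 = d * d * d by rewrite !expnS expn0 muln1 mulnA.
    rewrite -[2 ^ 12]/(1024 * 4); move: PP.
    by move: (P) (2 ^ _) => p e; clear; nia.
  by rewrite leq_mul2r grid_const_ge orbT.
pose p := take (size s - l) s; pose w := drop (size s - l) s.
have sE : s = p ++ w ++ [::] by rewrite cats0 cat_take_drop.
have size_w : size w = l by rewrite size_drop size_s; lia.
have w_uniq : uniq w by apply: drop_uniq.
have cardA : a0 <= #|[set x in w]|.
  by rewrite cardsE (card_uniqP w_uniq) size_w /l leq_pmull // muln_gt0 expn_gt0.
have size_p : h * (q * l) <= size p by rewrite size_take_min size_s; lia.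
have [c [[_ card_c rich_c disj_c] _]] :=
  chain tT s_uniq s_median d_gt0 m_gt0 sE size_w (subxx _) cardA size_p.
have layer_card n : #|[set x : grid_vertex d k | grid_layer x == n]| <= m.
  rewrite /m; case: (d) d_gt0 => // d' _; exact: card_grid_layer.
have card_c' i : i <= h -> 2 * m <= #|c i|.
  by move/card_c; apply: leq_trans; rewrite /a0 leq_mul2r; apply/orP; right; nia.
have [f [f_inj fT]] := layered_embedding (@grid_step_layer d k) (@grid_step_fun d k)
  (@grid_step_inj d k) (@grid_step_label d k) (@grid_layer_max d k) layer_card
  d_gt0 m_gt0 card_c' disj_c rich_c.
exists f; split=> // x y /existsP[j xy]; exact: fT xy.
Qed.

Theorem corollary1p4 (d : nat) (hd : 1 <= d) (k : nat) (hk : 1 <= k) :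
  exists r : nat,
    is_oriented_ramsey (@grid d k) r /\
    r <= grid_const d * #|grid_vertex d k|.
Proof.
have := grid_unavoidable hd hk; move: (_ * _) => N.
(* Descent from the bound to the least unavoidable number; the case distinction is classical, since
   unavoidability quantifies over all tournaments. *)
elim/ltn_ind: N => N IH unavoidable_N.
have [[M [lt_MN unavoidable_M]]|minimal] :=
  classic (exists M, M < N /\ tournament_unavoidable (@grid d k) M).
  have [r [ramsey_r le_rM]] := IH M lt_MN unavoidable_M.
  by exists r; split=> //; lia.
exists N; split=> //; split=> // M unavoidable_M; rewrite leqNgt; apply/negP => lt_MN.
by apply: minimal; exists M.
Qed.
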